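(* Let $q\in\mathbb{T}$, $q\neq1$, and let $(S,T)$ be a $q$-commuting pair on a Hilbert space $H$, where $S$ is normal. If $\alpha$ is an eigenvalue of $S$ (or $T$) and $H_\alpha$ is the minimal subspace reducing $(S,T)$ that contains the eigenspace $H_{S,\alpha}$, then the pair $(S|_{H_\alpha},T|_{H_\alpha})$ takes one of the following forms. (a) For some $n\ge1$ with $q^i\neq1$ for $i=1,\dots,n-1$, and with $\beta=q^{s}\alpha$ for some integer $s\le 0$, $$S|_{H_\alpha}=\mathrm{diag}(J_{\beta},J_{q\beta},\dots,J_{q^{n-1}\beta}),$$ and: if $q^n\neq1$, then neither $\bar q\beta$ nor $q^n\beta$ is an eigenvalue of $S|_{H_\alpha}$ and $$T|_{H_\alpha}=\begin{pmatrix}0&\cdots&\cdots&0\\ T_1&\ddots&&\vdots\\ &\ddots&\ddots&\vdots\\ 0&&T_{n-1}&0\end{pmatrix};$$ if $q^n=1$, then $T|_{H_\alpha}$ has the more general form $$T|_{H_\alpha}=\begin{pmatrix}0&\cdots&0&T_n\\ T_1&\ddots&&0\\ &\ddots&\ddots&\vdots\\ 0&&T_{n-1}&0\end{pmatrix}.$$ (b) For $\beta=q^{s}\alpha$ with some integer $s$ and for $\mathcal{J}$ equal to one of $\{0,1,2,\dots\}$, $\{0,-1,-2,\dots\}$, $\mathbb{Z}$, the numbers $q^i\beta$, $i\in\mathcal{J}$, are pairwise different eigenvalues of $S$, the operator $S|_{H_\alpha}$ is block diagonal with diagonal blocks $J_{q^i\beta}$, $i\in\mathcal{J}$, arranged in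 increasing order of $i$, and the only possibly nonzero blocks of $T|_{H_\alpha}$ are those immediately below the diagonal, $T_i$, mapping the $(i-1)$-st summand to the $i$-th one ($i-1,i\in\mathcal{J}$).
   Context: A pair $(S,T)$ of bounded operators on $H$ is $q$-commuting ($|q|=1$) if $ST=qTS$. A closed subspace reduces an operator if it is invariant under the operator and its adjoint; it reduces the pair if it reduces both operators. $H_{S,\alpha}$ is the (generalized) eigenspace of $S$ for $\alpha$; as $S$ is normal, it equals $\ker(S-\alpha I)$. $J_{\gamma}$ denotes the part of the Jordan matrix of $S|_{H_\alpha}$ corresponding to the eigenvalue $\gamma$, and the block matrices are taken with respect to the decomposition of $H_\alpha$ into the corresponding eigenspaces of $S|_{H_\alpha}$.
   Formalization: The eigenvalue α is assumed nonzero: for α = 0 an eigenvalue of S the claim fails (H = ℂ, S = 0, T = 1, q not a root of unity); if 0 is an eigenvalue of T only, H_α is the zero space. *)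

(* Defs.v *)
From HB Require Import structures.
From mathcomp Require Export all_boot all_order all_algebra.
From mathcomp Require Export sesquilinear complex.
From mathcomp Require Export boolp classical_sets reals topology normedtype.

Set Implicit Arguments.
Unset Strict Implicit.
Unset Printing Implicit Defensive.

Import Order.TTheory GRing.Theory Num.Theory numFieldNormedType.Exports.

Local Open Scope classical_set_scope.
Local Open Scope ring_scope.

                                                                            
                                                                         
                                                                          
Definition norm_from_dot (R : realType) (H : completeNormedModType R[i])
    (dot : {dot H for Num.conj}) : Prop :=
  forall x : H, `|x| ^+ 2 = dot x x.

Definition bounded_operator (R : realType) (H : completeNormedModType R[i])
    (A : {linear H -> H}) : Prop :=
  exists c : R[i], forall x : H, `|A x| <= c * `|x|.

                                                                               
                                                                           
Definition adjoint (R : realType) (H : completeNormedModType R[i])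
    (dot : {dot H for Num.conj}) (A : H -> H) : H -> H :=
  fun y => xget 0 [set z | forall x : H, dot (A x) y = dot x z].

Definition normal_operator (R : realType) (H : completeNormedModType R[i])
    (dot : {dot H for Num.conj}) (A : H -> H) : Prop :=
  forall x : H, A (adjoint dot A x) = adjoint dot A (A x).

Definition q_commuting (R : realType) (H : completeNormedModType R[i])
    (q : R[i]) (S T : H -> H) : Prop :=
  forall x : H, S (T x) = q *: T (S x).

Definition closed_subspace (R : realType) (H : completeNormedModType R[i])
    (M : set H) : Prop :=
  [/\ M 0, (forall (a : R[i]) (x y : H), M x -> M y -> M (a *: x + y))
    & closed M].

Definition invariant_under (H : Type) (A : H -> H) (M : set H) : Prop :=
  forall x : H, M x -> M (A x).

Definition reduces (R : realType) (H : completeNormedModType R[i])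
    (dot : {dot H for Num.conj}) (A : H -> H) (M : set H) : Prop :=
  [/\ closed_subspace M, invariant_under A M & invariant_under (adjoint dot A) M].

Definition reduces_pair (R : realType) (H : completeNormedModType R[i])
    (dot : {dot H for Num.conj}) (S T : H -> H) (M : set H) : Prop :=
  reduces dot S M /\ reduces dot T M.

                                                                     
Definition eigenspace_on (R : realType) (H : completeNormedModType R[i])
    (A : H -> H) (M : set H) (gamma : R[i]) : set H :=
  [set x | M x /\ A x = gamma *: x].

Definition eigenvalue_on (R : realType) (H : completeNormedModType R[i])
    (A : H -> H) (M : set H) (gamma : R[i]) : Prop :=
  exists2 x : H, eigenspace_on A M gamma x & x != 0.

Definition min_reducing (R : realType) (H : completeNormedModType R[i])
    (dot : {dot H for Num.conj}) (S T : H -> H) (alpha : R[i]) : set H :=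
  smallest (reduces_pair dot S T) (eigenspace_on S setT alpha).

                                                                            
Definition orthogonal_sum (R : realType) (H : completeNormedModType R[i])
    (dot : {dot H for Num.conj}) (J : set int) (K : int -> set H)
    (M : set H) : Prop :=
  [/\ forall i, J i -> closed_subspace (K i),
      forall i j, J i -> J j -> i <> j ->
        forall x y, K i x -> K j y -> dot x y = 0
    & M = smallest (@closed_subspace R H) (\bigcup_(i in J) K i)].

Definition is_proj (R : realType) (H : completeNormedModType R[i])
    (dot : {dot H for Num.conj}) (K : set H) (x y : H) : Prop :=
  K y /\ forall z, K z -> dot (x - y) z = 0.

                                                                            
                   
Definition block_is (R : realType) (H : completeNormedModType R[i])
    (dot : {dot H for Num.conj}) (A : H -> H) (K L : set H) (B : H -> H)
    : Prop :=
  forall x, L x -> is_proj dot K (A x) (B x).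

                                                                             
Definition block_diagonal (R : realType) (H : completeNormedModType R[i])
    (dot : {dot H for Num.conj}) (S : H -> H) (J : set int)
    (K : int -> set H) (gamma : int -> R[i]) : Prop :=
  forall i j, J i -> J j ->
    block_is dot S (K i) (K j) (fun x => if i == j then gamma i *: x else 0).

Definition blocks_supported (R : realType) (H : completeNormedModType R[i])
    (dot : {dot H for Num.conj}) (T : H -> H) (J : set int)
    (K : int -> set H) (E : int -> int -> Prop) : Prop :=
  forall i j, J i -> J j -> ~ E i j ->
    block_is dot T (K i) (K j) (fun _ => 0).

Definition subdiagonal (i j : int) : Prop := i = j + 1.

Definition cyclic_subdiagonal (n : nat) (i j : int) : Prop :=
  i = j + 1 \/ (i = 0 /\ j = n%:Z - 1).

                                                                              
                                                                          
                                      
Definition block_form (R : realType) (H : completeNormedModType R[i])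
    (dot : {dot H for Num.conj}) (q : R[i]) (S T : H -> H) (M : set H)
    (beta : R[i]) (J : set int) (E : int -> int -> Prop) : Prop :=
  let gamma i := q ^ i * beta in
  let K i := eigenspace_on S M (gamma i) in
  [/\ orthogonal_sum dot J K M, block_diagonal dot S J K gamma
    & blocks_supported dot T J K E].

                                                                           
                                                                           
                                    
Definition form_a (R : realType) (H : completeNormedModType R[i])
    (dot : {dot H for Num.conj}) (q : R[i]) (S T : H -> H) (alpha : R[i])
    (M : set H) : Prop :=
  exists (n : nat) (s : int) (beta : R[i]),
    let J := [set i : int | 0 <= i < n%:Z] in
    [/\ (1 <= n)%N /\ (forall i : nat, (1 <= i < n)%N -> q ^+ i != 1),
        s <= 0 /\ beta = q ^ s * alpha,
        M <> [set 0] -> forall i, J i -> eigenvalue_on S M (q ^ i * beta),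
        q ^+ n != 1 ->
          [/\ ~ eigenvalue_on S M (q^* * beta),
              ~ eigenvalue_on S M (q ^+ n * beta)
            & block_form dot q S T M beta J subdiagonal]
      & q ^+ n = 1 ->
          block_form dot q S T M beta J (cyclic_subdiagonal n)].

Definition form_b (R : realType) (H : completeNormedModType R[i])
    (dot : {dot H for Num.conj}) (q : R[i]) (S T : H -> H) (alpha : R[i])
    (M : set H) : Prop :=
  exists (s : int) (beta : R[i]) (J : set int),
    [/\ beta = q ^ s * alpha,
        [\/ J = [set i | 0 <= i], J = [set i | i <= 0] | J = setT],
        forall i j, J i -> J j -> i <> j -> q ^ i * beta <> q ^ j * beta,
        forall i, J i -> eigenvalue_on S M (q ^ i * beta)
      & block_form dot q S T M beta J subdiagonal].

(* Main.v *)
From HB Require Import structures.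
Require Import Defs.
From mathcomp Require Import ring lra zify.

Set Implicit Arguments.
Unset Strict Implicit.
Unset Printing Implicit Defensive.

Import Order.TTheory GRing.Theory Num.Theory numFieldNormedType.Exports.

Local Open Scope classical_set_scope.
Local Open Scope ring_scope.

(** The relation S T = q T S says that T maps ker (S - g) into ker (S - q g).
    As S is normal, its eigenvectors are also eigenvectors of its adjoint, for
    the conjugate eigenvalue, so taking adjoints in the relation gives that the
    adjoint of T maps ker (S - g) into ker (S - q^-1 g): no commutation theorem
    for normal operators is involved, because only eigenvectors matter
    ([q_commuting_eigen], [q_commuting_adjoint_eigen]).

    Let M be the minimal reducing subspace and K_k the eigenspace of S on M for
    q ^ k * alpha.  If a set J of exponents contains that of alpha, and one
    cannot leave it by a step j -> j + 1 or j -> j - 1 without reaching a zero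
    eigenspace or coming back to an eigenvalue already indexed by J, then the
    closed span of the K_j with j in J reduces both operators and contains
    ker (S - alpha).  By minimality it is M ([min_reducing_closed_span]).  The
    K_j belong to distinct eigenvalues of a normal operator, hence are mutually
    orthogonal, and both block forms follow ([min_reducing_block_form]).

    It remains to take for J the longest run of consecutive exponents around 0
    at which K_k is nonzero.
    - A run stopped on both sides, from -a to b, gives (a), with q ^ m != 1 for
      0 < m <= a + b + 1.  Otherwise the eigenvalue just after the run would be
      equal to one inside it ([form_a_of_finite_run]).
    - A run stopped on one side only, or never stopped when q is not a root of
      unity, gives (b) ([form_b_of_infinite_run]).
    - If no K_k vanishes and q has order n, then n consecutive exponents list
      all the eigenvalues once, and T also maps the last eigenspace into the
      first one ([form_a_of_root_of_unity]).
    If alpha is not an eigenvalue of S, then M is zero and (a) holds with n = 1.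

    All of this relies on the adjoint of a bounded operator satisfying the
    adjoint identity, that is, on the Riesz representation theorem, which is
    proved first by minimizing a quadratic functional. *)

(** * Inner products and the Riesz representation theorem *)

(** Evaluate at the minimum t = - g / p.  It bounds an inner product by the size
    of a quadratic form, both in the Cauchy-Schwarz inequality and for an
    approximate minimizer. *)
Lemma nonneg_quadratic_discr (R : realType) (a g p : R) : 0 <= p ->
  (forall t, 0 <= a + 2 * t * g + t ^+ 2 * p) -> g ^+ 2 <= a * p.
Proof.
move=> p0 H.
have [p_eq0|p_neq0] := eqVneq p 0.
  have [->|g0] := eqVneq g 0; first by rewrite p_eq0 mulr0 expr0n.
  (* the affine function left takes the value -1 at this t *)
  have := H (- (a + 1) / (2 * g)); rewrite p_eq0 mulr0 addr0.
  have -> : a + 2 * (- (a + 1) / (2 * g)) * g = -1 by field; rewrite ?g0//.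
  by rewrite ler0N1.
have pp : 0 < p by rewrite lt_def p_neq0.
have := H (- g / p).
have -> : a + 2 * (- g / p) * g + (- g / p) ^+ 2 * p = (a * p - g ^+ 2) / p.
  by field.
by rewrite pmulr_lge0 ?invr_gt0// subr_ge0.
Qed.

Section InnerProduct.
Context (R : realType) (H : completeNormedModType R[i]).
Context (dot : {dot H for Num.conj}) (Hdot : norm_from_dot dot).

(* The real scalar product and norm, so that estimates and infima live in R. *)
Let b (x y : H) : R := complex.Re (dot x y).
Let n (x : H) : R := complex.Re `|x|.

Lemma dotC x y : dot x y = (dot y x)^*.
Proof. by rewrite hermC expr0 mul1r. Qed.

Let norm_n x : `|x| = (n x)%:C%C.
Proof. by rewrite /n RRe_real// normr_real. Qed.

Let n_ge0 x : 0 <= n x.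
Proof. by rewrite -ler0c -norm_n. Qed.

Let bxx x : b x x = n x ^+ 2.
Proof. by rewrite /b -Hdot norm_n -rmorphXn. Qed.

Let bC x y : b x y = b y x.
Proof. by rewrite /b dotC; case: (dot y x). Qed.

Let bDl x y z : b (x + y) z = b x z + b y z.
Proof. by rewrite /b linearDl raddfD. Qed.

Let bDr x y z : b z (x + y) = b z x + b z y.
Proof. by rewrite /b linearDr raddfD. Qed.

Let bZl (t : R) x z : b (t%:C%C *: x) z = t * b x z.
Proof.
by rewrite /b linearZl_LR/=; case: (dot x z) => u v /=; rewrite mul0r subr0.
Qed.

Let bZr (t : R) x z : b z (t%:C%C *: x) = t * b z x.
Proof. by rewrite bC bZl bC. Qed.

Let bBl x y z : b (x - y) z = b x z - b y z.
Proof. by rewrite /b linearBl raddfB. Qed.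

Let bBr x y z : b z (x - y) = b z x - b z y.
Proof. by rewrite /b linearBr raddfB. Qed.

Let b_CS x y : `|b x y| <= n x * n y.
Proof.
rewrite -(ler_pXn2r (n:=2))// ?nnegrE ?mulr_ge0// real_normK ?num_real//.
rewrite exprMn -!bxx.
apply: nonneg_quadratic_discr; first by rewrite bxx sqr_ge0.
move=> t; have := sqr_ge0 (n (x + t%:C%C *: y)); rewrite -bxx.
rewrite !(bDl, bDr, bZl, bZr) (bC y x).
lra.
Qed.

(** The real inequality applied after rotating x so that the product becomes
    real and nonnegative. *)
Lemma cauchy_schwarz x y : `|dot x y| <= `|x| * `|y|.
Proof.
have [->|w0] := eqVneq (dot x y) 0; first by rewrite normr0 mulr_ge0.
have := le_trans (ler_norm _) (b_CS ((dot x y)^* *: x) y).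
rewrite -lecR rmorphM/= -!norm_n normrZ norm_conjC -mulrA.
rewrite /b linearZl_LR/= mulrC -normCK RRe_real ?rpredX ?normr_real// expr2.
by rewrite ler_pM2l// normr_gt0.
Qed.

Lemma dot_inj y z : (forall x, dot x y = dot x z) -> y = z.
Proof.
move=> h; apply/eqP; rewrite -subr_eq0 -(dnorm_eq0 dot).
by rewrite linearBr/= h subrr.
Qed.

(** A minimizer z of J x = |x|^2 - 2 Re (f x) satisfies Re <h, z> = Re (f h) for
    all h, and replacing h by 'i h gives the imaginary parts.  By the
    parallelogram identity, points where J is close to its infimum are close to
    each other, so the minimizing sets generate a Cauchy filter.  Its limit
    is used only through nearby approximate minimizers, which avoids the
    continuity of J. *)
Lemma riesz_representation (f : {scalar H}) :
  (exists c : R[i], forall x, `|f x| <= c * `|x|) ->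
  exists z, forall x, f x = dot x z.
Proof.
move=> [c0 fc0].
pose c := complex.Re c0; pose rf x := complex.Re (f x).
have rfD x y : rf (x + y) = rf x + rf y by rewrite /rf raddfD raddfD.
have rfZ (t : R) x : rf (t%:C%C *: x) = t * rf x.
  by rewrite /rf linearZ/=; case: (f x) => u v /=; rewrite mul0r subr0.
have fc x : `|rf x| <= c * n x.
  have := fc0 x; rewrite lecE => /andP[_].
  rewrite norm_n mulrC -complexr0 /=; case: c0 @c {fc0} => c1 c2 /= le1.
  rewrite /rf; apply: le_trans (_ : _ <= complex.Re `|f x|) _.
    have := normc_ge_Re (f x); rewrite lecE => /andP[_ /=].
    by case: (f x).
  by move: le1; rewrite mul0r subr0 mulrC.
pose J x := n x ^+ 2 - 2 * rf x.
have J_lb x : - c ^+ 2 <= J x.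
  have := fc x; rewrite ler_norml => /andP[_ h]; rewrite /J.
  have : 0 <= (n x - c) ^+ 2 by exact: sqr_ge0.
  rewrite sqrrB; lra.
pose m := inf (range J).
have Jinf : has_inf (range J).
  split; first by exists (J 0), 0.
  by exists (- c ^+ 2) => _ [x _ <-].
have mJ x : m <= J x by apply: (ge_inf (proj2 Jinf)); exists x.
pose A (e : R) := [set x | J x < m + e].
have A_ne e : 0 < e -> exists x, A e x.
  move=> e0; have [_ [x _ <-] Jx] := inf_adherent e0 Jinf.
  by exists x.
(* compare J x and J y with J at the midpoint *)
have parallelogram x y :
    n (x - y) ^+ 2 + 4 * m <= 2 * (J x + J y).
  have := mJ ((2^-1 : R)%:C%C *: (x + y)).
  rewrite /J rfZ rfD -!bxx !(bDl, bDr, bBl, bBr, bZl, bZr) (bC y x).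
  lra.
pose F := filter_from [set e : R | 0 < e] A.
have FF : ProperFilter F.
  apply: filter_from_proper; last by move=> e /A_ne [x]; exists x.
  apply: filter_from_filter; first by exists 1 => /=.
  move=> e1 e2 /= e10 e20; exists (Num.min e1 e2); first by rewrite lt_min e10.
  by move=> x /=; rewrite /A/= addr_minr lt_min => /andP[].
have Fcvg : cvg F.
  apply: cauchy_cvg; apply/cauchyP => eps eps0.
  pose e := complex.Re eps.
  have epsE : eps = e%:C%C by rewrite /e RRe_real// gtr0_real.
  have e0 : 0 < e by move: eps0; rewrite epsE (ltcR 0).
  have d0 : 0 < e ^+ 2 / 4 by rewrite divr_gt0// exprn_gt0.
  have [x Ax] := A_ne _ d0.
  exists x; exists (e ^+ 2 / 4) => // y Ay.
  rewrite -ball_normE /= norm_n epsE ltcR.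
  rewrite -(ltr_pXn2r (n:=2))// ?nnegrE ?(ltW e0)//.
  have := parallelogram x y; move: Ax Ay; rewrite /A /=; lra.
pose z := lim F.
have z_approx e : 0 < e -> exists u, n (z - u) < e /\ J u < m + e ^+ 2.
  move=> e0; have e'0 : 0 < e%:C%C :> R[i] by rewrite (ltcR 0).
  have Fb : F (ball z e%:C%C) by apply: Fcvg; exact: nbhsx_ballx.
  have FA : F (A (e ^+ 2)) by exists (e ^+ 2) => //=; rewrite exprn_gt0.
  have [u [zu Au]] := filter_ex (filterI Fb FA).
  by exists u; split=> //; move: zu; rewrite -ball_normE/= norm_n ltcR.
have crit h : b h z = rf h.
  suff small e : 0 < e -> `|b h z - rf h| <= e.
    apply/eqP; rewrite -subr_eq0 -normr_le0 leNgt; apply/negP => pos.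
    have := small (`|b h z - rf h| / 2); rewrite divr_gt0// => /(_ isT).
    by move: pos; lra.
  move=> e0.
  have h1 : 0 < n h + 1 by rewrite ltr_wpDl.
  have [d d0 dE] : exists2 d, 0 < d & d * (2 * (n h + 1)) = e.
    exists (e / (2 * (n h + 1))); first by rewrite divr_gt0// mulr_gt0.
    by rewrite divfK// gt_eqF// mulr_gt0.
  have [u [zu Ju]] := z_approx _ d0.
  (* J (u + t h) >= m for all t, and J u < m + d ^ 2: bound the coefficient
     of t by the discriminant *)
  have gu : `|b h u - rf h| <= d * n h.
    rewrite -(ler_pXn2r (n:=2))// ?nnegrE ?mulr_ge0// ?(ltW d0)//.
    rewrite real_normK ?num_real// exprMn.
    apply: nonneg_quadratic_discr; first exact: sqr_ge0.
    move=> t; have := mJ (u + t%:C%C *: h).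
    move: Ju; rewrite /J rfD rfZ -!bxx !(bDl, bDr, bZl, bZr) (bC u h).
    lra.
  have -> : b h z - rf h = b h (z - u) + (b h u - rf h) by rewrite bBr; ring.
  apply: (le_trans (ler_normD _ _)).
  have := b_CS h (z - u).
  have : n h * n (z - u) <= n h * d by rewrite ler_wpM2l// ltW.
  by move: gu d0 dE; lra.
exists z => x.
(* Re ('i * w) = - Im w, hence 'i *: x yields the imaginary part at x *)
have ReI w : complex.Re ('i%C * w) = - complex.Im w :> R.
  by rewrite mulrC ReiNIm.
apply/eqP; rewrite eq_complex; apply/andP; split; apply/eqP.
  by rewrite -[LHS]crit.
apply: oppr_inj.
have := crit ('i%C *: x); rewrite /rf /b linearZ/= linearZl_LR/=.
by rewrite !ReI.
Qed.
End InnerProduct.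

(** * Closed subspaces and bounded linear maps *)

Section ClosedSubspaces.
Context (R : realType) (H : completeNormedModType R[i]).

Lemma linear_map0 (B : H -> H) : linear B -> B 0 = 0.
Proof. by move=> /(_ (-1) 0 0); rewrite !scaler0 addr0 scaleN1r addNr. Qed.

Lemma bounded_linear_map_continuous (B : H -> H) : linear B ->
  (exists c : R[i], forall x, `|B x| <= c * `|x|) -> continuous B.
Proof.
move=> Blin [c Bc].
have Bd x y : `|B x - B y| <= `|c| * `|x - y|.
  have -> : B x - B y = B (x - y).
    by rewrite -scaleN1r addrC -Blin scaleN1r addrC.
  rewrite -[in leRHS](normr_id (x - y)) -normrM ger0_norm//.
  exact: le_trans (Bc _).
have c1 : 0 < `|c| + 1 by rewrite ltr_wpDl.
move=> x; apply/cvgrPdist_lt => e e0.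
have := @nbhsx_ballx _ _ x (e / (`|c| + 1)) (divr_gt0 e0 c1).
apply: filterS => y; rewrite -ball_normE /= => xy.
apply: le_lt_trans (Bd _ _) _.
apply: (@le_lt_trans _ _ ((`|c| + 1) * `|x - y|)).
  by rewrite ler_wpM2r// lerDl.
by rewrite mulrC -ltr_pdivlMr.
Qed.

Lemma closed_subspace_preimage (B : H -> H) (M : set H) : linear B ->
  (exists c : R[i], forall x, `|B x| <= c * `|x|) ->
  closed_subspace M -> closed_subspace (B @^-1` M).
Proof.
move=> Blin Bb [M0 ML Mc]; split.
- by rewrite /preimage/= linear_map0.
- by move=> a x y /= Mx My; rewrite Blin; exact: ML.
- apply: closed_comp Mc => x _.
  exact: bounded_linear_map_continuous.
Qed.

Lemma closed_subspace_bigcap (C : set (set H)) :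
  (forall M, C M -> closed_subspace M) ->
  closed_subspace (\bigcap_(M in C) M).
Proof.
move=> CM; split.
- by move=> M /CM[].
- move=> a x y Mx My M CM'; have [_ ML _] := CM _ CM'.
  by apply: ML; [exact: Mx|exact: My].
- by apply: closed_bigI => M /CM[].
Qed.

Lemma closed_subspace_smallest (G : set H) :
  closed_subspace (smallest (@closed_subspace R H) G).
Proof. by apply: closed_subspace_bigcap => M []. Qed.

Lemma closed_subspace0 : closed_subspace [set (0 : H)].
Proof.
split=> //; first by move=> a x y -> ->; rewrite scaler0 addr0.
exact/accessible_closed_set1/hausdorff_accessible/norm_hausdorff.
Qed.

Lemma closed_subspaceI (M N : set H) :
  closed_subspace M -> closed_subspace N -> closed_subspace (M `&` N).
Proof.
move=> [M0 ML Mc] [N0 NL Nc]; split; first by [].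
  by move=> a x y [? ?] [? ?]; split; [exact: ML|exact: NL].
exact: closedI.
Qed.

Lemma closed_subspaceZ (M : set H) (a : R[i]) (x : H) :
  closed_subspace M -> M x -> M (a *: x).
Proof. by move=> [M0 ML _] Mx; rewrite -[_ *: _]addr0; exact: ML. Qed.

Lemma closed_subspace_eigenspace (A : {linear H -> H}) (M : set H) (g : R[i]) :
  bounded_operator A -> closed_subspace M ->
  closed_subspace (eigenspace_on A M g).
Proof.
move=> [c Ac] Ms.
have -> : eigenspace_on A M g = M `&` (fun x => A x - g *: x) @^-1` [set 0].
  apply/seteqP; split=> x [Mx /= Ax]; split=> //.
    by rewrite /= Ax subrr.
  by apply/eqP; rewrite -subr_eq0 Ax.
apply: closed_subspaceI => //; apply: closed_subspace_preimage closed_subspace0.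
  by move=> a x y; rewrite linearP scalerDr !scalerBr !scalerA (mulrC g) addrACA opprD.
exists (c + `|g|) => x; rewrite mulrDl -normrZ.
by apply: (le_trans (ler_normB _ _)); rewrite lerD2r.
Qed.

(** The points sent by B into the closed span form a closed subspace. *)
Lemma invariant_smallest (B : H -> H) (G : set H) : linear B ->
  (exists c : R[i], forall x, `|B x| <= c * `|x|) ->
  (forall x, G x -> smallest (@closed_subspace R H) G (B x)) ->
  invariant_under B (smallest (@closed_subspace R H) G).
Proof.
move=> Blin Bb GB; apply: (smallest_sub _ GB).
by apply: closed_subspace_preimage => //; exact: closed_subspace_smallest.
Qed.

End ClosedSubspaces.

(** * Adjoints and eigenvectors of normal operators *)

Section Adjoint.
Context (R : realType) (H : completeNormedModType R[i]).
Context (dot : {dot H for Num.conj}) (Hdot : norm_from_dot dot).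
Context (A : {linear H -> H}) (Ab : bounded_operator A).
Local Notation "A '^#'" := (adjoint dot A) (at level 2).

(** The defining property of [adjoint]; it holds because Riesz representation of
    x |-> <A x, y> makes the set searched by [xget] nonempty. *)
Lemma adjointr x y : dot (A x) y = dot x (A^# y).
Proof.
have lin : linear_for *%R (fun x => dot (A x) y).
  by move=> a u v; rewrite linearP linearPl.
pose f : {scalar H} := HB.pack (fun x => dot (A x) y)
  (GRing.isLinear.Build _ _ _ _ _ lin).
have [|z fz] := @riesz_representation _ _ _ Hdot f.
  case: Ab => c Ac; exists (c * `|y|) => u.
  apply: (le_trans (cauchy_schwarz Hdot _ _)).
  by rewrite mulrAC ler_wpM2r.
have /= -> // : [set z | forall u, dot (A u) y = dot u z] (A^# y).
by apply: xgetPex; exists z.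
Qed.

Lemma adjointl x y : dot (A^# x) y = dot x (A y).
Proof. by rewrite dotC -adjointr -dotC. Qed.

Lemma adjoint_linear : linear (A^#).
Proof.
move=> a x y; apply: (dot_inj (dot:=dot)) => u.
by rewrite -adjointr !linearDr/= !linearZr_LR/= -!adjointr.
Qed.

Lemma adjoint_bounded : exists c : R[i], forall x, `|A^# x| <= c * `|x|.
Proof.
have [c Ac] := Ab; exists c => y.
have [->|y0] := eqVneq (A^# y) 0.
  by rewrite normr0; apply: le_trans (Ac y).
have y1 : 0 < `|A^# y| by rewrite normr_gt0.
rewrite -(ler_pM2r y1) -expr2 Hdot -adjointr.
rewrite -[leLHS]ger0_norm ?adjointr//.
rewrite -adjointr; apply: (le_trans (cauchy_schwarz Hdot _ _)).
by rewrite mulrAC ler_wpM2r.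
Qed.

(** For A normal, |A x - g x| = |A^# x - g^* x|. *)
Lemma normal_eigenE (Anormal : normal_operator dot A) x (g : R[i]) :
  A x = g *: x <-> A^# x = g^* *: x.
Proof.
have : dot (A x - g *: x) (A x - g *: x)
     = dot (A^# x - g^* *: x) (A^# x - g^* *: x).
  rewrite !(linearBl, linearBr)/= !(linearZl_LR, linearZr_LR)/=.
  rewrite conjCK.
  have -> : dot (A x) (A x) = dot (A^# x) (A^# x).
    by rewrite adjointr -Anormal -adjointl.
  rewrite (adjointr x x) (adjointl x x); ring.
move=> E; split=> e; apply/eqP; rewrite -subr_eq0 -(dnorm_eq0 dot).
  by rewrite -E e subrr linear0r.
by rewrite E e subrr linear0r.
Qed.

Lemma normal_eigen_orthogonal (Anormal : normal_operator dot A) x y (g d : R[i]) :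
  g != d -> A x = g *: x -> A y = d *: y -> dot x y = 0.
Proof.
move=> gd Ax /(normal_eigenE Anormal) Ay.
have /eqP : g * dot x y = d * dot x y.
  have := adjointr x y.
  by rewrite Ax Ay linearZl_LR linearZr_LR/= conjCK.
by rewrite -subr_eq0 -mulrBl mulf_eq0 subr_eq0 (negPf gd) => /eqP.
Qed.
End Adjoint.

(** * The minimal reducing subspace as a sum of eigenspaces *)

Lemma eigenspace_on_trivial (R : realType) (H : completeNormedModType R[i])
    (A : H -> H) (N : set H) (g : R[i]) :
  ~ eigenvalue_on A N g -> forall x, eigenspace_on A N g x -> x = 0.
Proof.
move=> nK x Kx; apply: contrapT => x0.
by apply: nK; exists x => //; exact/eqP.
Qed.

Section MinimalReducingSubspace.
Context (R : realType) (H : completeNormedModType R[i]).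
Context (dot : {dot H for Num.conj}) (Hdot : norm_from_dot dot).
Context (q : R[i]) (q_unit : `|q| = 1).
Context (S T : {linear H -> H}).
Context (Sb : bounded_operator S) (Tb : bounded_operator T).
Context (ST : q_commuting q S T) (Sn : normal_operator dot S).
Local Notation "A '^#'" := (adjoint dot A) (at level 2).

Let q_neq0 : q != 0.
Proof. by rewrite -normr_eq0 q_unit oner_eq0. Qed.

Lemma conj_unit : q^* = q^-1.
Proof. by rewrite invC_norm q_unit expr1n invr1 mul1r. Qed.

Lemma q_commuting_eigen x g : S x = g *: x -> S (T x) = (q * g) *: T x.
Proof. by move=> Sx; rewrite ST Sx linearZ scalerA. Qed.

Lemma q_commuting_adjoint x : S^# (T^# x) = q *: T^# (S^# x).
Proof.
apply: (dot_inj (dot:=dot)) => y.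
rewrite linearZr_LR/= -!adjointr// ST linearZl_LR/=.
by rewrite mulrA conj_unit mulVf// mul1r.
Qed.

(** Pass to the adjoint of S on eigenvectors, use the adjoint relation, and come
    back; the conjugate of q is q^-1. *)
Lemma q_commuting_adjoint_eigen x g :
  S x = g *: x -> S (T^# x) = (q^-1 * g) *: T^# x.
Proof.
move=> /(normal_eigenE Hdot Sb Sn) Sx; apply/(normal_eigenE Hdot Sb Sn).
have TZ a : T^# (a *: x) = a *: T^# x.
  have T0 := linear_map0 (adjoint_linear Hdot Tb).
  by have := adjoint_linear Hdot Tb a x 0; rewrite addr0 T0 addr0.
by rewrite q_commuting_adjoint Sx TZ scalerA -conj_unit rmorphM/= conjCK.
Qed.

Context (alpha : R[i]).
Local Notation M := (min_reducing dot S T alpha).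
Local Notation K := (eigenspace_on S M).

Lemma min_reducing_reduces : reduces_pair dot S T M.
Proof.
split; split.
- by apply: closed_subspace_bigcap => N [[[? _ _] _] _].
- by move=> x Mx N NC; have [[[_ SN _] _] _] := NC; exact: SN (Mx _ NC).
- by move=> x Mx N NC; have [[[_ _ SN] _] _] := NC; exact: SN (Mx _ NC).
- by apply: closed_subspace_bigcap => N [[[? _ _] _] _].
- by move=> x Mx N NC; have [[_ [_ TN _]] _] := NC; exact: TN (Mx _ NC).
- by move=> x Mx N NC; have [[_ [_ _ TN]] _] := NC; exact: TN (Mx _ NC).
Qed.

Let M_closed : closed_subspace M.
Proof. by have [[]] := min_reducing_reduces. Qed.

Lemma min_reducing_eigenspace_closed g : closed_subspace (K g).
Proof. exact: closed_subspace_eigenspace. Qed.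

Lemma sub_min_reducing x : S x = alpha *: x -> M x.
Proof. by move=> Sx; apply: sub_gen_smallest; split. Qed.

Lemma min_reducing_eigenspace_T g x : K g x -> K (q * g) (T x).
Proof.
move=> [Mx Sx]; split; last exact: q_commuting_eigen.
by have [_ [_ TM _]] := min_reducing_reduces; exact: TM.
Qed.

Lemma min_reducing_eigenspace_adjoint g x : K g x -> K (q^-1 * g) (T^# x).
Proof.
move=> [Mx Sx]; split; last exact: q_commuting_adjoint_eigen.
by have [_ [_ _ TM]] := min_reducing_reduces; exact: TM.
Qed.

(** The closed span on the right reduces S and T, since the two hypotheses on
    steps keep T and its adjoint inside it; minimality of M does the rest.  A
    step may also end at an index outside J whose eigenvalue is already indexed
    in J: this is how the cyclic case closes up. *)
Lemma min_reducing_closed_span (J : set int) (beta : R[i]) (i0 : int) :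
  J i0 -> q ^ i0 * beta = alpha ->
  (forall j, J j ->
     (exists2 k, J k & q ^ (j + 1) * beta = q ^ k * beta) \/
     ~ eigenvalue_on S M (q ^ (j + 1) * beta)) ->
  (forall j, J j ->
     (exists2 k, J k & q ^ (j - 1) * beta = q ^ k * beta) \/
     ~ eigenvalue_on S M (q ^ (j - 1) * beta)) ->
  M = smallest (@closed_subspace R H)
        (\bigcup_(j in J) K (q ^ j * beta)).
Proof.
move=> Ji0 i0E up down.
set N := smallest _ _.
have Ncs : closed_subspace N by exact: closed_subspace_smallest.
have KN j x : J j -> K (q ^ j * beta) x -> N x.
  by move=> Jj Kx; apply: sub_gen_smallest; exists j.
have KN' j x : (exists2 k, J k & q ^ j * beta = q ^ k * beta) \/
    ~ eigenvalue_on S M (q ^ j * beta) -> K (q ^ j * beta) x -> N x.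
  move=> [[k Jk ->]|/eigenspace_on_trivial K0]; first exact: KN.
  by move=> /K0 ->; case: Ncs.
have Slin : linear S by move=> a x y; rewrite linearP.
have Tlin : linear T by move=> a x y; rewrite linearP.
apply/seteqP; split; last first.
  by apply: smallest_sub => // x [j _ []].
apply: smallest_sub; last first.
  move=> x [_ Sx]; apply: (KN i0) => //; rewrite i0E.
  by split=> //; exact: sub_min_reducing.
split; split=> //.
- apply: invariant_smallest Slin Sb _ => x [j Jj [Mx Sx]].
  by rewrite Sx; exact: closed_subspaceZ Ncs (KN j x Jj (conj Mx Sx)).
- apply: invariant_smallest; [exact: adjoint_linear|exact: adjoint_bounded|].
  move=> x [j Jj [Mx Sx]]; have /(normal_eigenE Hdot Sb Sn) -> := Sx.
  exact: closed_subspaceZ Ncs (KN j x Jj (conj Mx Sx)).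
- apply: invariant_smallest Tlin Tb _ => x [j Jj Kx].
  apply: (KN' (j + 1)); first exact: up.
  by rewrite addrC expfzDr// expr1z -mulrA; exact: min_reducing_eigenspace_T.
- apply: invariant_smallest; [exact: adjoint_linear|exact: adjoint_bounded|].
  move=> x [j Jj Kx]; apply: (KN' (j - 1)); first exact: down.
  by rewrite addrC expfzDr// exprN1 -mulrA; exact: min_reducing_eigenspace_adjoint.
Qed.

Lemma min_reducing_block_form (J : set int) (beta : R[i]) (i0 : int)
    (E : int -> int -> Prop) :
  J i0 -> q ^ i0 * beta = alpha ->
  (forall j, J j ->
     (exists2 k, J k & q ^ (j + 1) * beta = q ^ k * beta) \/
     ~ eigenvalue_on S M (q ^ (j + 1) * beta)) ->
  (forall j, J j ->
     (exists2 k, J k & q ^ (j - 1) * beta = q ^ k * beta) \/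
     ~ eigenvalue_on S M (q ^ (j - 1) * beta)) ->
  (forall i j, J i -> J j -> i <> j -> q ^ i * beta != q ^ j * beta) ->
  (forall i j, J i -> J j -> ~ E i j ->
     q ^ (j + 1) * beta != q ^ i * beta \/
     ~ eigenvalue_on S M (q ^ (j + 1) * beta)) ->
  block_form dot q S T M beta J E.
Proof.
move=> Ji0 i0E up down inj offE.
have ortho g d x y : g != d -> K g x -> K d y -> dot x y = 0.
  by move=> gd [_ Sx] [_ Sy]; apply: normal_eigen_orthogonal gd Sx Sy.
split.
- split.
  + by move=> i _; exact: min_reducing_eigenspace_closed.
  + move=> i j Ji Jj ij x y; apply: ortho; exact: inj.
  + exact: min_reducing_closed_span i0E up down.
- move=> i j Ji Jj x Kx; have [Mx Sx] := Kx.
  have [->|/eqP ij] := eqVneq i j; rewrite Sx.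
    split; first exact: closed_subspaceZ (min_reducing_eigenspace_closed _) Kx.
    by move=> z _; rewrite subrr linear0l.
  split; first by case: (min_reducing_eigenspace_closed (q ^ i * beta)).
  move=> z Kz; rewrite subr0 linearZl_LR/= (ortho _ _ _ _ _ Kx Kz) ?mulr0//.
  by apply: inj => //; exact/nesym.
- move=> i j Ji Jj Eij x Kx.
  split; first by case: (min_reducing_eigenspace_closed (q ^ i * beta)).
  move=> z Kz; rewrite subr0.
  have KTx : K (q ^ (j + 1) * beta) (T x).
    by rewrite addrC expfzDr// expr1z -mulrA; exact: min_reducing_eigenspace_T.
  have [ne|nK] := offE i j Ji Jj Eij; first exact: ortho ne KTx Kz.
  by rewrite (eigenspace_on_trivial nK KTx) linear0l.
Qed.
End MinimalReducingSubspace.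

(** * The run of nonzero eigenspaces around alpha *)

Lemma forall_or_initial_segment (P : nat -> Prop) : P 0%N ->
  (forall k, P k) \/ exists b, (forall k, (k <= b)%N -> P k) /\ ~ P b.+1.
Proof.
move=> P0; have [all|/existsNP ex] := pselect (forall k, P k); [by left|right].
have exb : exists k, (fun k => ~~ `[< P k >]) k.
  by have [k nP] := ex; exists k; exact/asboolPn.
have [[|b] /asboolPn nPb minb] := ex_minnP exb; first by [].
exists b; split=> // k kb; apply: contrapT => /asboolPn /minb.
by rewrite ltnNge kb.
Qed.

(** Two equal terms q ^ i * beta and q ^ j * beta make q a root of unity of order
    at most |i - j|. *)
Lemma exprz_mulr_inj (F : fieldType) (q beta : F) (i j : int) :
  q != 0 -> beta != 0 -> (forall m, (0 < m <= `|i - j|)%N -> q ^+ m != 1) ->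
  i <> j -> q ^ i * beta != q ^ j * beta.
Proof.
move=> q0 b0.
wlog ij : i j / i < j.
  move=> W; have [ij|ji|->//] := ltgtP i j; first exact: W.
  by rewrite distnC eq_sym => ? ?; apply: W => //; exact/nesym.
move=> noroot _; apply/eqP => /(mulIf b0) E.
have ij0 : (0 < `|i - j| <= `|i - j|)%N by lia.
have /eqP[] := noroot _ ij0.
apply: (mulfI (expfz_neq0 i q0)); rewrite mulr1 [RHS]E exprnP -expfzDr//.
by congr (q ^ _); lia.
Qed.

Section Forms.
Context (R : realType) (H : completeNormedModType R[i]).
Context (dot : {dot H for Num.conj}) (Hdot : norm_from_dot dot).
Context (q : R[i]) (q_unit : `|q| = 1).
Context (S T : {linear H -> H}).
Context (Sb : bounded_operator S) (Tb : bounded_operator T).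
Context (ST : q_commuting q S T) (Sn : normal_operator dot S).
Context (alpha : R[i]) (alpha_neq0 : alpha != 0).
Local Notation M := (min_reducing dot S T alpha).
Local Notation P k := (eigenvalue_on S M (q ^ k * alpha)).

Let q_neq0 : q != 0.
Proof. by rewrite -normr_eq0 q_unit oner_eq0. Qed.

Let shift (i s : int) : q ^ i * (q ^ s * alpha) = q ^ (i + s) * alpha.
Proof. by rewrite mulrA -expfzDr. Qed.

Let beta_neq0 (s : int) : q ^ s * alpha != 0.
Proof. by rewrite mulf_neq0// expfz_neq0. Qed.

Let period (m : nat) (i : int) : q ^+ m = 1 -> q ^ (i + m%:Z) = q ^ i.
Proof. by move=> qm; rewrite expfzDr// -exprnP qm mulr1. Qed.

(** Case (a) with q ^ n != 1, for n = a + b + 1 and beta = q ^ (- a) * alpha.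
    Nonzero eigenspaces are required only when M is nonzero, so that a = b = 0
    also covers the zero subspace. *)
Lemma form_a_of_finite_run (a b : nat) :
  (forall m, (0 < m <= (a + b).+1)%N -> q ^+ m != 1) ->
  (M <> [set 0] -> forall k : int, - a%:Z <= k <= b%:Z -> P k) ->
  ~ P (- a%:Z - 1) -> ~ P (b%:Z + 1) ->
  form_a dot q S T alpha M.
Proof.
move=> noroot Pab nPa nPb.
exists (a + b).+1, (- a%:Z), (q ^ (- a%:Z) * alpha) => J.
have JE i : J i <-> 0 <= i < (a + b).+1%:Z by [].
split.
- by split=> // i ib; apply: noroot; lia.
- by split=> //; lia.
- by move=> Mn0 i /JE Ji; rewrite shift; apply: Pab => //; lia.
- move=> _; split.
  + rewrite conj_unit// -exprN1 shift addrC; exact: nPa.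
  + rewrite exprnP shift; have -> : (a + b).+1%:Z - a%:Z = b%:Z + 1 by lia.
    exact: nPb.
  + apply: (@min_reducing_block_form _ _ _ Hdot _ q_unit _ _ Sb Tb ST Sn _ _ _ a%:Z).
    * by apply/JE; lia.
    * by rewrite shift subrr expr0z mul1r.
    * move=> j /JE Jj; have [jb|jb] := ltP (j + 1) (a + b).+1%:Z.
        by left; exists (j + 1) => //; apply/JE; lia.
      right; rewrite shift.
      by have -> : j + 1 - a%:Z = b%:Z + 1 by lia.
    * move=> j /JE Jj; have [jb|jb] := ltP (j - 1) 0; last first.
        by left; exists (j - 1) => //; apply/JE; lia.
      right; rewrite shift.
      by have -> : j - 1 - a%:Z = - a%:Z - 1 by lia.
    * move=> i j /JE Ji /JE Jj; apply: exprz_mulr_inj => // m mb.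
      by apply: noroot; lia.
    * move=> i j /JE Ji /JE Jj nij; left; apply: exprz_mulr_inj => //.
        by move=> m mb; apply: noroot; lia.
      exact/nesym.
- by move=> /eqP; rewrite (negPf (noroot _ _))//; lia.
Qed.

(** Here the steps n - 1 -> n and 0 -> -1 leave the index range but return to the
    eigenvalues with indices 0 and n - 1. *)
Lemma form_a_of_root_of_unity (n : nat) : (0 < n)%N -> q ^+ n = 1 ->
  (forall m, (0 < m < n)%N -> q ^+ m != 1) -> (forall k, P k) ->
  form_a dot q S T alpha M.
Proof.
move=> n0 qn noroot Pall.
exists n, 0, (q ^ 0 * alpha) => J.
have JE i : J i <-> 0 <= i < n%:Z by [].
have wrap i := period i qn.
split.
- by [].
- by [].
- by move=> _ i _; rewrite shift; exact: Pall.
- by rewrite qn eqxx.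
- move=> _.
  have inj (i j : int) : J i -> J j -> i <> j ->
      q ^ i * (q ^ 0 * alpha) != q ^ j * (q ^ 0 * alpha).
    move=> /JE Ji /JE Jj; apply: exprz_mulr_inj => // m mb.
    by apply: noroot; lia.
  apply: (@min_reducing_block_form _ _ _ Hdot _ q_unit _ _ Sb Tb ST Sn _ _ _ 0) => //.
  + by rewrite !expr0z !mul1r.
  + move=> j /JE Jj; left; have [jb|jb] := ltP (j + 1) n%:Z.
      by exists (j + 1) => //; apply/JE; lia.
    exists 0; first by apply/JE; lia.
    have -> : j + 1 = 0 + n%:Z by lia.
    by rewrite wrap.
  + move=> j /JE Jj; left; have [jb|jb] := ltP (j - 1) 0; last first.
      by exists (j - 1) => //; apply/JE; lia.
    exists (n%:Z - 1); first by apply/JE; lia.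
    have -> : n%:Z - 1 = (j - 1) + n%:Z by lia.
    by rewrite wrap.
  + move=> i j /JE Ji /JE Jj nE; left.
    have [jb|jb] := ltP (j + 1) n%:Z.
      apply: inj; [by apply/JE; lia|by apply/JE|].
      by move=> e; apply: nE; left.
    have e : j + 1 = 0 + n%:Z by lia.
    rewrite e wrap; apply: inj; [by apply/JE; lia|by apply/JE|].
    by move=> i0; apply: nE; right; split; [|lia].
Qed.

Lemma form_b_of_infinite_run (s : int) (J : set int) :
  (forall m, (0 < m)%N -> q ^+ m != 1) ->
  [\/ J = [set i | 0 <= i], J = [set i | i <= 0] | J = setT] ->
  J (- s) -> (forall i, J i -> P (i + s)) ->
  (forall j, J j -> J (j + 1) \/ ~ P (j + 1 + s)) ->
  (forall j, J j -> J (j - 1) \/ ~ P (j - 1 + s)) ->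
  form_b dot q S T alpha M.
Proof.
move=> noroot Jshape Js PJ up down.
have inj (i j : int) : i <> j -> q ^ i * (q ^ s * alpha) != q ^ j * (q ^ s * alpha).
  by apply: exprz_mulr_inj => // m /andP[+ _]; exact: noroot.
exists s, (q ^ s * alpha), J; split=> //.
- by move=> i j _ _ /inj /eqP.
- by move=> i /PJ; rewrite shift.
- apply: (@min_reducing_block_form _ _ _ Hdot _ q_unit _ _ Sb Tb ST Sn _ _ _ (- s)).
  + exact: Js.
  + by rewrite shift addNr expr0z mul1r.
  + by move=> j /up[Jj|nP]; [left; exists (j + 1)|right; rewrite shift].
  + by move=> j /down[Jj|nP]; [left; exists (j - 1)|right; rewrite shift].
  + by move=> i j _ _; exact: inj.
  + by move=> i j _ _ nE; left; apply: inj; exact/nesym.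
Qed.

Lemma form_a_of_not_eigenvalue : q != 1 -> ~ eigenvalue_on S setT alpha ->
  form_a dot q S T alpha M.
Proof.
move=> q1 nSalpha.
have M0 : M = [set 0].
  apply/seteqP; split=> [|x ->]; last first.
    by case: (min_reducing_reduces dot S T alpha) => -[[]].
  apply: smallest_sub; last first.
    by move=> x /(eigenspace_on_trivial nSalpha).
  have S0 := linear_map0 (adjoint_linear Hdot Sb).
  have T0 := linear_map0 (adjoint_linear Hdot Tb).
  by split; (split; first exact: closed_subspace0);
    move=> x ->; rewrite /= ?linear0 ?S0 ?T0.
have nP k : ~ P k by move=> [x [+ _]]; rewrite M0 => /= ->; rewrite eqxx.
apply: (@form_a_of_finite_run 0 0) => //.
by move=> [|[|m]].
Qed.

(** The four cases: the run of nonzero eigenspaces is or is not stopped above and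
    below.  When it is stopped, q ^ m = 1 is excluded because translation by m
    would carry the first zero eigenspace to a nonzero one. *)
Lemma forms_of_eigenvalue : eigenvalue_on S setT alpha ->
  form_a dot q S T alpha M \/ form_b dot q S T alpha M.
Proof.
move=> [x [_ Sx] x0].
have P0 : P 0.
  by exists x => //; rewrite expr0z mul1r; split=> //; exact: sub_min_reducing.
have [up|[b [up nb]]] := @forall_or_initial_segment (fun k => P k%:Z) P0;
have [down|[a [down na]]] := @forall_or_initial_segment (fun k => P (- k%:Z)) P0.
- have Pall k : P k by case: k => [k|k]; [exact: up|exact: (down k.+1)].
  have [[n [n0 qn]]|noroot] := pselect (exists n, (0 < n)%N /\ q ^+ n = 1).
    left; have exn : exists n, (fun n => (0 < n)%N && (q ^+ n == 1)) n.
      by exists n; rewrite n0 qn eqxx.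
    have [m /andP[m0 /eqP qm] minm] := ex_minnP exn.
    apply: (@form_a_of_root_of_unity m) => //.
    move=> k /andP[k0 km]; apply/negP => qk.
    by have := minm k; rewrite k0 qk leqNgt km => /(_ isT).
  right; apply: (@form_b_of_infinite_run 0 setT) => //.
  + by move=> m m0; apply/eqP => qm; apply: noroot; exists m.
  + by apply: Or33.
  + by left.
  + by left.
- have nb : ~ P (- a%:Z - 1) by have <- : - a.+1%:Z = - a%:Z - 1 :> int by lia.
  have Pge (k : int) : - a%:Z <= k -> P k.
    case: k => k; first by move=> _; exact: up.
    by move=> ka; apply: (down k.+1); lia.
  right; apply: (@form_b_of_infinite_run (- a%:Z) [set i | 0 <= i]).
  + move=> m m0; apply/eqP => qm; apply: nb.
    by rewrite -(period _ qm); apply: Pge; lia.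
  + exact: Or31.
  + by rewrite /=; lia.
  + by move=> i /= i0; apply: Pge; lia.
  + by move=> j /= j0; left; lia.
  + move=> j /= j0; have [j1|j1] := ltP (j - 1) 0; [right|by left].
    by have -> : j - 1 - a%:Z = - a%:Z - 1 by lia.
- have nb' : ~ P (b%:Z + 1) by have <- : b.+1%:Z = b%:Z + 1 :> int by lia.
  have Ple (k : int) : k <= b%:Z -> P k.
    case: k => k; first by move=> kb; apply: up; lia.
    by move=> _; exact: (down k.+1).
  right; apply: (@form_b_of_infinite_run b%:Z [set i | i <= 0]).
  + move=> m m0; apply/eqP => qm; apply: nb'.
    by rewrite -[b%:Z + 1](subrK m%:Z) (period _ qm); apply: Ple; lia.
  + exact: Or32.
  + by rewrite /=; lia.
  + by move=> i /= i0; apply: Ple; lia.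
  + move=> j /= j0; have [j1|j1] := ltP 0 (j + 1); [right|by left].
    by have -> : j + 1 + b%:Z = b%:Z + 1 by lia.
  + by move=> j /= j0; left; lia.
- have nb' : ~ P (b%:Z + 1) by have <- : b.+1%:Z = b%:Z + 1 :> int by lia.
  have na' : ~ P (- a%:Z - 1) by have <- : - a.+1%:Z = - a%:Z - 1 :> int by lia.
  have Pin (k : int) : - a%:Z <= k <= b%:Z -> P k.
    case: k => k; first by move=> kb; apply: up; lia.
    by move=> ka; apply: (down k.+1); lia.
  left; apply: (@form_a_of_finite_run a b) => //.
  move=> m mab; apply/eqP => qm; apply: nb'.
  by rewrite -[b%:Z + 1](subrK m%:Z) (period _ qm); apply: Pin; lia.
Qed.

End Forms.

Theorem theorem4p10 (R : realType) (H : completeNormedModType R[i])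
    (dot : {dot H for Num.conj}) (Hdot : norm_from_dot dot)
    (q : R[i]) (q_unit : `|q| = 1) (q_neq1 : q != 1)
    (S T : {linear H -> H})
    (S_bounded : bounded_operator S) (T_bounded : bounded_operator T)
    (ST : q_commuting q S T) (S_normal : normal_operator dot S)
    (alpha : R[i]) (alpha_neq0 : alpha != 0)
    (alpha_eigen : eigenvalue_on S setT alpha \/ eigenvalue_on T setT alpha) :
  form_a dot q S T alpha (min_reducing dot S T alpha) \/
  form_b dot q S T alpha (min_reducing dot S T alpha).
Proof.
have [Salpha|nSalpha] := pselect (eigenvalue_on S setT alpha).
  exact: forms_of_eigenvalue.
by left; exact: form_a_of_not_eigenvalue.
Qed.
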